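(* Let $G$ be an $n$-node cycle with $k$ noise-free leaders ($1\le k\le n$), with $n$ written $n=k\ell+q$, where $\ell$ and $q$ are integers with $0\le q<k$. Let $S=\{s_1,\dots,s_k\}$ be the leaders, listed in clockwise order, and let $c$ be the $k$-vector of graph distances between adjacent leaders, i.e., $c_i$ is the clockwise distance from leader $s_i$ to leader $s_{i+1}$ for $i=1,\dots,k-1$, and $c_k$ is the clockwise distance from leader $s_k$ to leader $s_1$. Then: 1. The coherence of $G$ is $$ R_{NF}(S)=\frac1{12}\left(c^{\mathsf T}c-k\right). $$ 2. $S$ is an optimal solution to the $k$-leader selection problem (for noise-free leaders) if and only if $c\in\mathcal C$, where $$ \mathcal C=\Big\{ d \;\Big|\; d_i\in\{\ell,\ell+1\},\ i=1,\dots,k,\ \sum_{i=1}^k d_i=n\Big\}. $$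
   Context: All edge weights equal $1$. The nodes of the cycle are $1,\dots,n$ in clockwise direction, and the distance from $x$ to $y$ is the number of edges traversed going clockwise from $x$ to $y$ (when $k=1$, $c_1=n$). For a connected graph with Laplacian $L$ and nonempty leader set $S\subseteq V$, let $L_{ff}$ be the principal submatrix of $L$ indexed by $V\setminus S$. The coherence for noise-free leaders $S$ (total steady-state variance of the followers under the dynamics $\dot x_f=-L_{ff}x_f+d_f$, with $d_f$ a vector of zero-mean unit-variance white noise processes) is $$R_{NF}(S)=\tfrac12\operatorname{tr}(L_{ff}^{-1}),$$ with value $0$ if $S=V$. The noise-free $k$-leader selection problem is to minimize $R_{NF}(S)$ over (nonempty) $S\subseteq V$ with $|S|\le k$. *)

(* Defs.v *)
From mathcomp Require Import all_boot all_order all_algebra.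

Set Implicit Arguments.
Unset Strict Implicit.
Unset Printing Implicit Defensive.

Import Order.TTheory GRing.Theory Num.Theory.
Local Open Scope ring_scope.

(* A simple graph on the nodes 0, ..., n-1 is a symmetric irreflexive relation. *)
Section Coherence.

Variables (R : realFieldType) (n : nat) (e : rel 'I_n).

Definition degree (x : 'I_n) : nat := #|[set y | e x y]|.

Definition laplacian : 'M[R]_n :=
  \matrix_(x, y) (if x == y then (degree x)%:R else - (e x y)%:R).

(* L_ff: the followers ~: S are enumerated by enum_val; the trace of the
   inverse does not depend on this enumeration. *)
Definition follower_laplacian (S : {set 'I_n}) : 'M[R]_#|~: S| :=
  mxsub enum_val enum_val laplacian.

(* If S is the set of all nodes, this is the trace of a 0 x 0 matrix, i.e. 0. *)
Definition R_NF (S : {set 'I_n}) : R :=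
  2%:R^-1 * \tr (invmx (follower_laplacian S)).

Definition optimal_NF (k : nat) (S : {set 'I_n}) : Prop :=
  [/\ S != set0, (#|S| <= k)%N &
      forall S' : {set 'I_n}, S' != set0 -> (#|S'| <= k)%N ->
        R_NF S <= R_NF S'].

End Coherence.

(* ordS is the successor modulo n, i.e. the next node clockwise.  This is the
   n-node cycle graph for 3 <= n only. *)
Definition cycle_graph (n : nat) : rel 'I_n :=
  [rel x y | (y == ordS x) || (x == ordS y)].
Arguments cycle_graph n : clear implicits.

Definition cw_dist (n : nat) (x y : 'I_n) : nat := ((y + (n - x)) %% n)%N.

(* Distance from a leader x to the next leader y: a single leader is its own
   successor, at distance n (one full turn). *)
Definition leader_dist (n : nat) (x y : 'I_n) : nat :=
  if x == y then n else cw_dist x y.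

(* Going once around clockwise from the first entry of s, one meets the entries
   of s in the listed order, without repetition. *)
Definition clockwise (n : nat) (s : seq 'I_n) : bool :=
  if s is x :: _ then sorted ltn [seq cw_dist x y | y <- s] else true.

(* Here ordS acts on 'I_k, so that the last entry is the distance from the
   last leader back to the first one. *)
Definition leader_distances (n k : nat) (s : k.-tuple 'I_n) : 'cV[nat]_k :=
  \col_i leader_dist (tnth s i) (tnth s (ordS i)).

Definition balanced_distances (n k l : nat) : pred 'cV[nat]_k :=
  [pred d : 'cV[nat]_k | [forall i, d i ord0 \in [:: l; l.+1]]
                         && ((\sum_(i < k) d i ord0)%N == n)].
Arguments balanced_distances n k l : clear implicits.

(* Main.v *)
Require Import Defs.
From mathcomp Require Import all_boot all_order all_algebra.
From mathcomp Require Import zify ring lra.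

Set Implicit Arguments.
Unset Strict Implicit.
Unset Printing Implicit Defensive.

Import Order.TTheory GRing.Theory Num.Theory.
Local Open Scope ring_scope.

(** The leaders cut the cycle into arcs, one from each leader [x] to the next
one, of length [gap S x].  A follower only interacts with the followers of its
own arc, because noise-free leaders act as grounded nodes; hence [L_ff] is block
diagonal, with one block per arc, and the block of an arc of length [d] is the
Dirichlet Laplacian of a path with [d - 1] interior nodes.  Its inverse is the
classical Green function [min(a,b) (d - max(a,b)) / d] of the positions [a] and
[b] along the arc.  The blocks are not separated explicitly: [green_mx] spreads
the Green function over pairs of nodes, with value zero across different arcs
and on leaders, and [invmx_follower] checks that it inverts [L_ff] as a whole.
Its diagonal sums to [(d^2 - 1) / 6] on an arc of length [d], so that
[12 R_NF(S)] is the sum of [gap^2 - 1] over the leaders ([R_NF_gap]).  For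
leaders listed clockwise the gaps are the entries of [c] ([clockwise_gap]),
which gives the first claim.

For the second claim, the integer inequality [(g - l) (g - l - 1) >= 0] is
tight exactly when [g] is [l] or [l + 1].  As the gaps add up to [n],
expanding [gap^2] around it gives
[[
  12 R_NF(S) = (2 l + 1) n - #|S| (l (l + 1) + 1) + sum of (g - l) (g - l - 1)
]]
([R_NF_excess]).  The middle term decreases with [#|S|], so with at most [k]
leaders the right-hand side is bounded below by its value for [k] leaders with
zero excess, and having fewer leaders never helps.  Leaders with balanced gaps
reach this bound and therefore are optimal; they exist ([balanced_leaders]), so
conversely an optimal set with [k] leaders must have zero excess, that is,
balanced gaps. *)

(** * Clockwise distances as integer arithmetic *)

(** Once distances and neighbours are written with conditionals instead of
remainders, statements on the cyclic order are linear arithmetic in each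
branch. *)
Ltac lia_if :=
  repeat match goal with
  | |- context [if ?b then _ else _] => destruct b eqn:?
  | H : context [if ?b then _ else _] |- _ => destruct b eqn:?
  end; lia.

Lemma val_ordS n (x : 'I_n) :
  ordS x = (if (x.+1 == n)%N then 0 else x.+1)%N :> nat.
Proof.
rewrite /=; case: eqP => [->|h]; first by rewrite modnn.
by rewrite modn_small //; have := ltn_ord x; lia.
Qed.

Lemma val_ord_pred n (x : 'I_n) :
  ord_pred x = (if (x == 0 :> nat)%N then n.-1 else x.-1)%N :> nat.
Proof.
have xn := ltn_ord x; rewrite /=; case: eqP => [->|h].
  by rewrite add0n modn_small //; lia.
have -> : ((x + n).-1 = x.-1 + n)%N by lia.
by rewrite modnDr modn_small //; lia.
Qed.

Lemma cw_distE n (x y : 'I_n) :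
  cw_dist x y = (if x <= y then y - x else n + y - x)%N.
Proof.
have xn := ltn_ord x; have yn := ltn_ord y; rewrite /cw_dist.
case: leqP => h; last by rewrite modn_small; lia.
have -> : (y + (n - x) = y - x + n)%N by lia.
by rewrite modnDr modn_small //; lia.
Qed.

Lemma cw_dist_lt n (x y : 'I_n) : (cw_dist x y < n)%N.
Proof. by rewrite ltn_mod; have := ltn_ord x; lia. Qed.

Lemma cw_dist_inj n (x : 'I_n) : injective (cw_dist x).
Proof.
move=> y z; rewrite !cw_distE => h; apply: val_inj => /=.
by have := ltn_ord x; have := ltn_ord y; have := ltn_ord z; lia_if.
Qed.

Lemma leader_distE n (x y : 'I_n) :
  leader_dist x y = (if x < y then y - x else n + y - x)%N.
Proof.
rewrite /leader_dist cw_distE -val_eqE /=.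
by have := ltn_ord x; have := ltn_ord y; lia_if.
Qed.

(** * Arcs between consecutive leaders *)

Section Gaps.

Variables (n : nat) (S : {set 'I_n}).

Definition next_leader (x : 'I_n) : 'I_n :=
  [arg min_(y < x in S) leader_dist x y].

Definition gap (x : 'I_n) : nat := leader_dist x (next_leader x).

(** The leader at the start of the arc containing [v], a leader being counted
in the arc that it starts.  The default value is never met when [S] is
nonempty. *)
Definition owner (v : 'I_n) : 'I_n :=
  odflt v [pick x in S | (cw_dist x v < gap x)%N].

Lemma next_leader_in x : x \in S -> next_leader x \in S.
Proof. by move=> xS; rewrite /next_leader; case: arg_minnP. Qed.

Lemma gap_min x y : x \in S -> y \in S -> (gap x <= leader_dist x y)%N.
Proof.
by move=> xS yS; rewrite /gap /next_leader; case: arg_minnP => // z _; apply.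
Qed.

Lemma gap_eq x y : x \in S -> y \in S ->
  (forall z, z \in S -> (leader_dist x y <= leader_dist x z)%N) ->
  gap x = leader_dist x y.
Proof.
move=> xS yS ymin; apply/eqP; rewrite eqn_leq gap_min //=.
by apply: ymin; apply: next_leader_in.
Qed.

Lemma gap_bounds x : (0 < gap x <= n)%N.
Proof.
rewrite /gap leader_distE; set y := next_leader x.
by have := ltn_ord x; have := ltn_ord y; lia_if.
Qed.

(** The leader [x] with the least clockwise distance to [v] works: if the leader
after [x] came no later than [v], it would be nearer to [v]. *)
Lemma owner_exists v : S != set0 ->
  exists2 x, x \in S & (cw_dist x v < gap x)%N.
Proof.
case/set0Pn=> x0 x0S.
case: (arg_minnP (fun x => cw_dist x v) x0S) => x xS xmin.
exists x => //; have := xmin _ (next_leader_in xS).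
rewrite /gap leader_distE !cw_distE; set y := next_leader x.
by have := ltn_ord x; have := ltn_ord y; have := ltn_ord v; lia_if.
Qed.

(** If [v] lies after both [x] and [y], one of these leaders lies between the
other one and [v], which contradicts the minimality of the gap. *)
Lemma owner_unique v x y : x \in S -> y \in S ->
  (cw_dist x v < gap x)%N -> (cw_dist y v < gap y)%N -> x = y.
Proof.
move=> xS yS hx hy; apply: val_inj => /=.
move: (leq_trans hx (gap_min xS yS)) (leq_trans hy (gap_min yS xS)).
rewrite !leader_distE !cw_distE.
by have := ltn_ord x; have := ltn_ord y; have := ltn_ord v; lia_if.
Qed.

Lemma ownerP v : S != set0 ->
  owner v \in S /\ (cw_dist (owner v) v < gap (owner v))%N.
Proof.
move=> S0; rewrite /owner; case: pickP => [x /andP[]|noP] //=.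
have [x xS xv] := owner_exists v S0.
by have := noP x; rewrite xS xv.
Qed.

Lemma owner_eq v x : x \in S -> (cw_dist x v < gap x)%N -> owner v = x.
Proof.
move=> xS xv; have S0 : S != set0 by apply/set0Pn; exists x.
by have [oS ov] := ownerP v S0; apply: owner_unique ov xv.
Qed.

Lemma owner_leader x : x \in S -> owner x = x.
Proof.
move=> xS; apply: owner_eq => //.
by rewrite cw_distE leqnn subnn; case/andP: (gap_bounds x).
Qed.

(** An arc is parametrized by the distance [j] from its leader, which takes each
value [j < gap x] once. *)
Lemma big_owner (V : nmodType) (x : 'I_n) (F : nat -> V) : x \in S ->
  \sum_(v | owner v == x) F (cw_dist x v) = \sum_(j < gap x) F j.
Proof.
move=> xS; have S0 : S != set0 by apply/set0Pn; exists x.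
have /andP[_ gn] := gap_bounds x.
rewrite (big_ord_widen _ _ gn).
pose h v := Ordinal (cw_dist_lt x v).
have hinj : injective h by move=> v w [/cw_dist_inj].
rewrite [RHS](reindex_inj hinj) /=; apply: eq_bigl => v.
apply/eqP/idP => [<-|]; last exact: owner_eq.
by have [] := ownerP v S0.
Qed.

Lemma big_by_owner (V : nmodType) (F : nat -> nat -> V) : S != set0 ->
  \sum_v F (gap (owner v)) (cw_dist (owner v) v) =
  \sum_(x in S) \sum_(j < gap x) F (gap x) j.
Proof.
move=> S0; rewrite (partition_big owner (mem S)) /=; last first.
  by move=> v _; have [] := ownerP v S0.
apply: eq_bigr => x xS; rewrite -big_owner //.
by apply: eq_bigr => v /eqP->.
Qed.

Lemma sum_gap : S != set0 -> (\sum_(x in S) gap x = n)%N.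
Proof.
move=> S0; have nE : (\sum_(v < n) 1 = n)%N by rewrite sum1_card card_ord.
rewrite -[RHS]nE; rewrite (big_by_owner (fun _ _ => 1%N) S0).
by apply: eq_bigr => x _; rewrite sum1_card card_ord.
Qed.

Lemma owner_ord_pred v : S != set0 -> v \notin S ->
  owner (ord_pred v) = owner v /\
  cw_dist (owner v) v = (cw_dist (owner v) (ord_pred v)).+1.
Proof.
move=> S0 vS; have [oS ov] := ownerP v S0.
have e : cw_dist (owner v) v = (cw_dist (owner v) (ord_pred v)).+1.
  have : owner v != v by apply: contraNneq vS => <-.
  rewrite !cw_distE -val_eqE val_ord_pred /=.
  by have := ltn_ord (owner v); have := ltn_ord v; lia_if.
by split=> //; apply: owner_eq => //; rewrite -e in ov *; lia.
Qed.

Lemma owner_ordS v : S != set0 -> v \notin S ->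
  if ordS v \in S then gap (owner v) = (cw_dist (owner v) v).+1
  else owner (ordS v) = owner v /\
       cw_dist (owner v) (ordS v) = (cw_dist (owner v) v).+1.
Proof.
move=> S0 vS; have [oS ov] := ownerP v S0; case: ifPn => wS.
  have := gap_min oS wS; rewrite leader_distE => h.
  move: ov h; rewrite !cw_distE val_ordS.
  by have := ltn_ord (owner v); have := ltn_ord v; lia_if.
have [e _] := owner_ord_pred S0 wS; rewrite ordSK in e.
by have [_ ] := owner_ord_pred S0 wS; rewrite ordSK -e.
Qed.

End Gaps.

(** * The excess of a gap over the balanced values *)

(** How much the square of [g] exceeds the chord through [l] and [l + 1]. *)
Definition excess (R : realFieldType) (l g : nat) : R :=
  (g%:R - l%:R) * (g%:R - l%:R - 1).

(** No integer lies strictly between [l] and [l + 1]. *)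
Lemma excess_ge0 (R : realFieldType) (l g : nat) : 0 <= excess R l g.
Proof.
rewrite /excess.
case: (leqP g l) => gl.
  have : g%:R <= l%:R :> R by rewrite ler_nat.
  by move=> h; nra.
have : l.+1%:R <= g%:R :> R by rewrite ler_nat.
by rewrite -natr1 => h; nra.
Qed.

Lemma excess_eq0 (R : realFieldType) (l g : nat) :
  (excess R l g == 0) = (g \in [:: l; l.+1]).
Proof.
by rewrite /excess mulf_eq0 -addrA -opprD natr1 !subr_eq0 !eqr_nat !inE.
Qed.

(** * The inverse of the follower Laplacian *)

Section Cycle.

Variables (R : realFieldType) (n : nat).
Hypothesis n_ge3 : (3 <= n)%N.

Lemma cycle_nbrs (u : 'I_n) :
  [set w | cycle_graph n u w] = [set ordS u; ord_pred u].
Proof.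
apply/setP=> w; rewrite !inE /=; congr (_ || _).
by apply/eqP/eqP => ->; rewrite ?ordSK ?ord_predK.
Qed.

(** This is where [3 <= n] matters: for smaller [n] the two neighbours of a node
coincide and its degree is not 2. *)
Lemma cycle_distinct (u : 'I_n) :
  [/\ ordS u != u, ord_pred u != u & ordS u != ord_pred u].
Proof.
have un := ltn_ord u.
split; apply/eqP => /(congr1 (@nat_of_ord n));
  rewrite ?val_ordS ?val_ord_pred; lia_if.
Qed.

Lemma sum_nbrs (V : nmodType) (f : 'I_n -> V) (u : 'I_n) :
  \sum_(w | cycle_graph n u w) f w = f (ordS u) + f (ord_pred u).
Proof.
have [_ _ sp] := cycle_distinct u.
rewrite (eq_bigl (mem [set ordS u; ord_pred u])); last first.
  by move=> w; rewrite -cycle_nbrs /= inE.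
by rewrite big_setU1 ?inE //= big_set1.
Qed.

Lemma laplacian_cycle (f : 'I_n -> R) (u : 'I_n) :
  \sum_w laplacian R (cycle_graph n) u w * f w =
  2 * f u - f (ordS u) - f (ord_pred u).
Proof.
have [su pu sp] := cycle_distinct u.
rewrite (bigD1 u) //= mxE eqxx /degree cycle_nbrs cards2 sp -addrA -opprD.
congr (_ + _); rewrite -sum_nbrs [in RHS]big_mkcond /= -sumrN.
rewrite [RHS](bigD1 u) //.
have -> : cycle_graph n u u = false.
  by rewrite /cycle_graph /= orbb eq_sym (negPf su).
rewrite /= oppr0 add0r.
apply: eq_bigr => w wu; rewrite mxE eq_sym (negPf wu).
by rewrite mulNr /cycle_graph /=; case: (_ || _); rewrite ?mul1r ?mul0r.
Qed.

(** The Green function of the second difference on [0, d] with zero boundary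
values. *)
Definition green (d a b : nat) : R :=
  (minn a b)%:R * (d%:R - (maxn a b)%:R) / d%:R.

(** As a function of [a], the Green function is affine on each side of [b], with
slopes [(d - b) / d] and [- b / d], so its slope drops by 1 at [b]. *)
Lemma green_diff (d a b : nat) : (a.+1 < d)%N -> (0 < b < d)%N ->
  2 * green d a.+1 b - green d a.+2 b - green d a b = (a.+1 == b)%:R.
Proof.
move=> ad /andP[b0 bd]; have d0 : d%:R != 0 :> R by rewrite pnatr_eq0; lia.
rewrite /green; case: (ltngtP a.+1 b) => h.
- have -> : minn a.+2 b = a.+2 by lia.
  have -> : minn a b = a by lia.
  have -> : maxn a.+2 b = b by lia.
  have -> : maxn a b = b by lia.
  by rewrite /=; field.
- have -> : minn a.+2 b = b by lia.
  have -> : minn a b = b by lia.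
  have -> : maxn a.+2 b = a.+2 by lia.
  have -> : maxn a b = a by lia.
  by rewrite /=; field.
- rewrite -h.
  have -> : minn a.+2 a.+1 = a.+1 by lia.
  have -> : minn a a.+1 = a by lia.
  have -> : maxn a.+2 a.+1 = a.+2 by lia.
  have -> : maxn a a.+1 = a.+1 by lia.
  by rewrite /=; field.
Qed.

Lemma sum_green_diag (d : nat) : (0 < d)%N ->
  6 * \sum_(j < d) green d j j = d%:R ^+ 2 - 1.
Proof.
move=> d_gt0; have d0 : d%:R != 0 :> R by rewrite pnatr_eq0; lia.
(* For a partial sum the cut-off [m] must be independent of [d], which also
     occurs in the summand. *)
have partial m : 6 * \sum_(j < m) green d j j =
    (3 * d%:R * m%:R * (m%:R - 1) - (m%:R - 1) * m%:R * (2 * m%:R - 1)) / d%:R.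
  elim: m => [|m IH]; first by rewrite big_ord0; field.
  rewrite big_ord_recr mulrDr IH /green minnn maxnn /=.
  by field.
by rewrite partial; field.
Qed.

Variable S : {set 'I_n}.
Hypothesis S_neq0 : S != set0.

Definition green_mx (u v : 'I_n) : R :=
  if owner S u == owner S v then
    green (gap S (owner S v)) (cw_dist (owner S v) u) (cw_dist (owner S v) v)
  else 0.

Lemma green_mx_leader u v : u \in S -> green_mx u v = 0.
Proof.
move=> uS; rewrite /green_mx owner_leader //; case: eqP => // <-.
by rewrite /green cw_distE leqnn subnn min0n !mul0r.
Qed.

(** Around a follower [u] the function [green_mx^~ v] is the Green function of
the arc of [u], or zero on another arc.  This includes the case in which the
next node is a leader: there [green_mx] vanishes, as does [green] at [a = d]. *)
Lemma laplacian_green u v : u \notin S -> v \notin S ->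
  2 * green_mx u v - green_mx (ordS u) v - green_mx (ord_pred u) v =
  (u == v)%:R.
Proof.
move=> uS vS; have [ou [_ ou_lt]] :=
  (owner_ord_pred S_neq0 uS, ownerP u S_neq0).
have [[pu du] [_ ov_lt]] := (ou, ownerP v S_neq0).
have [_ dv] := owner_ord_pred S_neq0 vS.
have := owner_ordS S_neq0 uS.
rewrite [green_mx u v]/green_mx [green_mx (ord_pred u) v]/green_mx pu.
case: (eqVneq (owner S u) (owner S v)) => [e|ne] su.
- have -> : (u == v) = (cw_dist (owner S v) u == cw_dist (owner S v) v).
    by rewrite (inj_eq (@cw_dist_inj _ _)).
  rewrite e in du ou_lt su *.
  have -> : green_mx (ordS u) v =
    green (gap S (owner S v))
      (cw_dist (owner S v) u).+1 (cw_dist (owner S v) v).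
    case: ifPn su => wS.
      move=> gE; rewrite green_mx_leader // gE /green.
      have -> : maxn (cw_dist (owner S v) u).+1 (cw_dist (owner S v) v)
                = (cw_dist (owner S v) u).+1 by lia.
      by rewrite subrr mulr0 mul0r.
    by case=> o dd; rewrite /green_mx o eqxx dd.
  rewrite du in ou_lt *; apply: green_diff => //.
  by rewrite ov_lt dv.
- have -> : green_mx (ordS u) v = 0.
    case: ifPn su => wS; first by rewrite green_mx_leader.
    by case=> o _; rewrite /green_mx o (negPf ne).
  rewrite mulr0 !subr0; case: eqP => // uv.
  by rewrite uv eqxx in ne.
Qed.

Lemma invmx_follower :
  invmx (follower_laplacian R (cycle_graph n) S) =
  \matrix_(i, j) green_mx (enum_val i) (enum_val j).
Proof.
set A := follower_laplacian _ _ _; set G := \matrix_(i, j) _.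
have AG : A *m G = 1%:M.
  apply/matrixP=> i j; rewrite !mxE.
  pose u := enum_val i; pose v := enum_val j.
  have uS : u \notin S by have := enum_valP i; rewrite inE.
  have vS : v \notin S by have := enum_valP j; rewrite inE.
  have -> : (i == j) = (u == v) by rewrite (inj_eq enum_val_inj).
  rewrite -(laplacian_green uS vS).
  (* Leaders contribute nothing since [green_mx] vanishes there, so the row of
     [L_ff] may be replaced with the full row of the Laplacian. *)
  rewrite -(laplacian_cycle (green_mx^~ v)) (bigID (mem (~: S))) /=.
  rewrite [X in _ = _ + X]big1 ?addr0; last first.
    by move=> w; rewrite inE negbK => wS; rewrite green_mx_leader ?mulr0.
  by rewrite [RHS]big_enum_val; apply: eq_bigr => w _; rewrite !mxE.
have [Au _] := mulmx1_unit AG.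
by rewrite -[LHS]mulmx1 -AG mulmxA mulVmx // mul1mx.
Qed.

Lemma R_NF_gap :
  R_NF R (cycle_graph n) S = 12%:R^-1 * \sum_(x in S) ((gap S x)%:R ^+ 2 - 1).
Proof.
have -> : \sum_(x in S) ((gap S x)%:R ^+ 2 - 1) =
          6 * \tr (invmx (follower_laplacian R (cycle_graph n) S)).
  rewrite invmx_follower /mxtrace.
  under [in RHS]eq_bigr => i _ do rewrite mxE.
  rewrite -(big_enum_val (fun v => green_mx v v)) /=.
  have -> : \sum_(v in ~: S) green_mx v v = \sum_v green_mx v v.
    rewrite [RHS](bigID (mem (~: S))) /= [X in _ = _ + X]big1 ?addr0 // => w.
    by rewrite inE negbK => wS; rewrite green_mx_leader.
  under [in RHS]eq_bigr => v _ do rewrite /green_mx eqxx.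
  rewrite (big_by_owner (fun d j => green d j j)) // mulr_sumr.
  apply: eq_bigr => x _; rewrite sum_green_diag //.
  by case/andP: (gap_bounds S x).
by rewrite /R_NF; field.
Qed.

(** Each [gap^2 - 1] is replaced by its expansion
[(2 l + 1) gap - (l (l + 1) + 1) + excess], and the gaps add up to [n]. *)
Lemma R_NF_excess (l : nat) :
  12%:R * R_NF R (cycle_graph n) S =
  (2 * l%:R + 1) * n%:R - #|S|%:R * (l%:R * (l%:R + 1) + 1) +
  \sum_(x in S) excess R l (gap S x).
Proof.
rewrite R_NF_gap mulrA divff ?pnatr_eq0 // mul1r.
rewrite -[in n%:R](sum_gap S_neq0) natr_sum mulr_sumr -sumr_const.
rewrite mulr_suml -sumrB -big_split /=.
by apply: eq_bigr => x _; rewrite /excess; ring.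
Qed.

End Cycle.

(** * Leaders listed clockwise *)

Section Clockwise.

Variables (n k : nat) (s : k.-tuple 'I_n).
Hypothesis s_cw : clockwise s.

Lemma clockwise_uniq : uniq s.
Proof.
move: s_cw; rewrite /clockwise; case: (tval s) => // x r h.
by apply: (@map_uniq _ _ (cw_dist x)); apply: sorted_uniq h;
  [apply: ltn_trans | apply: ltnn].
Qed.

(** Seen from the first listed leader, the positions [t] increase strictly from
0, so no listed leader lies strictly between an entry and the next one. *)
Lemma clockwise_gap (i : 'I_k) :
  gap [set x in s] (tnth s i) = leader_dist (tnth s i) (tnth s (ordS i)).
Proof.
suff nearest j : (leader_dist (tnth s i) (tnth s (ordS i)) <=
                  leader_dist (tnth s i) (tnth s j))%N.
  apply: gap_eq; rewrite ?inE ?mem_tnth // => z; rewrite inE => /tnthP[j ->].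
  exact: nearest.
have i0 : (0 < k)%N by apply: leq_trans (ltn_ord i).
pose o := Ordinal i0; pose t (j : 'I_k) := cw_dist (tnth s o) (tnth s j).
have tlt (a b : 'I_k) : (a < b)%N -> (t a < t b)%N.
  move=> ab; have x := tnth s o.
  have : sorted ltn [seq cw_dist (tnth s o) y | y <- s].
    have e : tnth s o = nth x s 0 by rewrite (tnth_nth x).
    by move: s_cw; rewrite e /clockwise; case: (tval s).
  move/(sorted_ltn_nth ltn_trans 0%N)/(_ a b).
  rewrite !inE size_map size_tuple !ltn_ord => /(_ isT isT ab).
  by rewrite !(nth_map x) ?size_tuple // /t !(tnth_nth x).
have [ij ji] := (tlt i j, tlt j i).
have ijE : i = j :> nat -> tnth s i = tnth s j :> nat by move/val_inj->.
(* After the last entry the successor is the first one, at position 0. *)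
have nx : if (i.+1 == k)%N then ordS i = o
          else ((t i < t (ordS i)) /\ (i < j -> t (ordS i) <= t j))%N.
  have iS := val_ordS i; case: ifP iS => _ iS; first exact: val_inj.
  split; first by apply: tlt; rewrite iS.
  rewrite leq_eqVlt => /orP[/eqP h|h].
    by rewrite (_ : ordS i = j) //; apply: val_inj; exact: etrans iS h.
  by apply/ltnW/tlt; rewrite iS.
have jk := ltn_ord j.
move: nx ij ji ijE; rewrite /t !leader_distE !cw_distE.
case: ifP => ik.
  move=> -> ij ji ijE.
  have := ltn_ord (tnth s i); have := ltn_ord (tnth s j).
  have := ltn_ord (tnth s o); lia_if.
have := ltn_ord (tnth s i); have := ltn_ord (tnth s j).
have := ltn_ord (tnth s o); have := ltn_ord (tnth s (ordS i)); lia_if.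
Qed.

Lemma big_clockwise (V : nmodType) (F : nat -> V) :
  \sum_(x in [set x in s]) F (gap [set x in s] x) =
  \sum_(i < k) F (leader_distances s i ord0).
Proof.
rewrite (eq_bigl (mem s)); last by move=> x; rewrite inE.
rewrite -big_uniq ?clockwise_uniq //= big_tuple.
by apply: eq_bigr => i _; rewrite mxE clockwise_gap.
Qed.

End Clockwise.

(** Placing leader [i] at node [i l + min(i, q)] makes the first [q] gaps equal
to [l + 1] and the other ones equal to [l]; the last gap closes the cycle
because [n = k l + q]. *)
Lemma balanced_leaders (n k l q : nat) : (0 < k <= n)%N -> (q < k)%N ->
  n = (k * l + q)%N ->
  exists s : k.-tuple 'I_n, clockwise s /\
    forall i, leader_distances s i ord0 \in [:: l; l.+1].
Proof.
move=> /andP[k0 kn] qk nE.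
(* Distinct positions need [0 < l]; if [l] were 0, then [n = q < k <= n]. *)
have l0 : (0 < l)%N by case: l nE => //; nia.
pose t i := (i * l + minn i q)%N.
have tlt i : (i < k)%N -> (t i < n)%N by rewrite /t => ik; nia.
have tmono i j : (i < j)%N -> (t i < t j)%N by rewrite /t => ij; nia.
pose s := [tuple Ordinal (tlt i (ltn_ord i)) | i < k].
have sE i : tnth s i = t i :> nat by rewrite tnth_mktuple.
have o0 : 'I_n by apply: Ordinal (leq_trans k0 kn).
have nthE i : (i < k)%N -> nth o0 s i = t i :> nat.
  by move=> ik; rewrite -(sE (Ordinal ik)) (tnth_nth o0).
exists s; split.
- have e : head o0 s = 0%N :> nat by rewrite -nth0 nthE // /t min0n.
  have srt : sorted ltn [seq cw_dist (head o0 s) y | y <- s].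
    apply/(sortedP 0%N) => i; rewrite size_map size_tuple => ik.
    rewrite !(nth_map o0) ?size_tuple //; last by lia.
    rewrite !cw_distE e !subn0 /= !nthE //; last by lia.
    exact: tmono.
  by move: srt; rewrite /clockwise; case: (tval s).
- move=> i; rewrite mxE leader_distE !sE val_ordS !inE.
  case: (eqVneq i.+1 k) => [ik|_]; last first.
    by rewrite tmono // /t; lia.
  have {}nE : n = (i.+1 * l + q)%N by rewrite ik.
  by rewrite /t; rewrite mulSn in nE; lia_if.
Qed.

Theorem theorem9 (R : realFieldType) (n k l q : nat)
    (hn : (3 <= n)%N) (hk : (1 <= k <= n)%N)
    (hq : (q < k)%N) (hnk : n = (k * l + q)%N)
    (S : {set 'I_n}) (s : k.-tuple 'I_n)
    (hcard : #|S| = k) (hS : S = [set x in s]) (hs : clockwise s) :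
  let c := leader_distances s in
  R_NF R (cycle_graph n) S = 12%:R^-1 * (((c^T *m c) 0 0)%:R - k%:R)
  /\ (optimal_NF R (cycle_graph n) k S <-> c \in balanced_distances n k l).
Proof.
subst S; set S := [set x in s] in hcard *.
move=> c; have k0 : (0 < k)%N by case/andP: hk.
have S0 : S != set0 by rewrite -card_gt0 hcard.
split.
  rewrite R_NF_gap // sumrB sumr_const hcard; congr (_ * (_ - _)).
  have /= -> := big_clockwise hs (fun g => g%:R ^+ 2 : R); rewrite mxE natr_sum.
  by apply: eq_bigr => i _; rewrite !mxE natrM expr2.
have excess0 (s' : k.-tuple 'I_n) : clockwise s' ->
    (forall i, leader_distances s' i ord0 \in [:: l; l.+1]) ->
    \sum_(x in [set x in s']) excess R l (gap [set x in s'] x) = 0.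
  move=> cw' bal.
  rewrite (big_clockwise cw' (excess R l)).
  by apply: big1 => i _; apply/eqP; rewrite excess_eq0.
have r12 : 0 < 12%:R :> R by rewrite ltr0n.
rewrite inE /=; split; last first.
  case/andP=> /forallP bal _; split; rewrite ?hcard // => S' S'0 S'k.
  rewrite -(ler_pM2l r12) !(R_NF_excess _ _ _ l) // hcard.
  rewrite excess0 // addr0.
  have : 0 <= \sum_(x in S') excess R l (gap S' x).
    by apply: sumr_ge0 => x _; apply: excess_ge0.
  have : #|S'|%:R <= k%:R :> R by rewrite ler_nat.
  have : 0 <= l%:R :> R by rewrite ler0n.
  nra.
case=> _ _ opt; apply/andP; split; last first.
  by apply/eqP; rewrite -(sum_gap S0); have /= -> := big_clockwise hs id.
have [s' [cw' bal]] := balanced_leaders hk hq hnk.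
pose S' := [set x in s'].
have S'k : #|S'| = k.
  by rewrite cardsE (card_uniqP (clockwise_uniq cw')) size_tuple.
have S'0 : S' != set0 by rewrite -card_gt0 S'k.
have := opt S' S'0; rewrite S'k => /(_ (leqnn _)).
rewrite -(ler_pM2l r12) !(R_NF_excess _ _ _ l) // hcard S'k.
rewrite (excess0 _ cw' bal) lerD2l.
rewrite (big_clockwise hs (excess R l)).
move=> le0; have {le0} : \sum_(i < k) excess R l (c i ord0) == 0.
  by rewrite eq_le le0 sumr_ge0 // => i _; apply: excess_ge0.
rewrite psumr_eq0; last by move=> i _; apply: excess_ge0.
move/allP => all0; apply/forallP => i.
by rewrite -(excess_eq0 R); apply: all0; apply: mem_index_enum.
Qed.
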